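(* Let $X=\mathbb{Z}[\frac12]\cap(0,1)$ with the action of Thompson's group $F$ and root $p=\frac58$. Let $k\ge1$ and for $i=1,\dots,k$ let $f_i:\mathcal{P}_f(X)\to\mathbb{R}$ be the min-function of a positive superharmonic function $\varphi_i:X\to\mathbb{R}$ satisfying $\varphi_i(q)\le\varphi_i(p)$ for all $q\in X$. Put $f=\sum_{i=1}^k\lambda_if_i$, where $\lambda_i$ are positive real numbers. Then there is a sequence $E_n\in\mathcal{P}_f(X)$, $n\in\mathbb{N}$, such that for any $g\in\mathcal{P}_f(X)\rtimes F$ the sequence $\frac{f(gE_n)}{f(E_n)}$ converges to $1$.
   Context: Thompson's group $F$ is the group of orientation-preserving piecewise linear homeomorphisms of $[0,1]$ with finitely many breakpoints, all dyadic rationals, and all slopes integer powers of $2$; it acts on $X=\mathbb{Z}[\frac12]\cap(0,1)$. It is generated by $a$ and $b$, where $a(x)=2x$ on $[0,\frac14]$, $a(x)=\frac x2+\frac38$ on $[\frac14,\frac34]$, $a(x)=x$ on $[\frac34,1]$; and $b(x)=x$ on $[0,\frac12]$, $b(x)=\frac x2+\frac14$ on $[\frac12,\frac34]$, $b(x)=x-\frac18$ on $[\frac34,\frac78]$, $b(x)=2x-1$ on $[\frac78,1]$. Root: $p=\frac58$. A function $\varphi:X\to\mathbb{R}$ is superharmonic if $\varphi(x)\ge\frac14(\varphi(ax)+\varphi(bx)+\varphi(a^{-1}x)+\varphi(b^{-1}x))$ for all $x\in X$. $\mathcal{P}_f(X)$ is the set of finite subsets of $X$. The lamplighter group $\mathcal{P}_f(X)\rtimes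 F$ has multiplication $(E,g)(E',h)=(E\,\Delta\,gE',gh)$ and acts on $\mathcal{P}_f(X)$ by $(E,g)(E')=E\,\Delta\,gE'$. The min-function of $\varphi$ is $f:\mathcal{P}_f(X)\to\mathbb{R}$, $f(E)=\min_{x\in E}\varphi(x)$ for $E\ne\varnothing$, $f(\varnothing)=\varphi(p)$. *)

(* Defs.v *)
From HB Require Import structures.
From mathcomp Require Import all_boot all_order all_algebra.
From mathcomp Require Import finmap.
From mathcomp Require Import all_classical all_reals all_analysis.
From mathcomp Require Import lra ring.

Set Implicit Arguments.
Unset Strict Implicit.
Unset Printing Implicit Defensive.

Import Order.TTheory GRing.Theory Num.Theory.
Import numFieldNormedType.Exports.

Local Open Scope fset_scope.
Local Open Scope classical_set_scope.
Local Open Scope ring_scope.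

Section Dyadic.
Context {R : realType}.
Implicit Types x y : R.

Definition dyadic (x : R) : Prop :=
  exists (m : int) (n : nat), x = m%:~R / 2 ^+ n.

Let exp2_neq0 n : 2 ^+ n != 0 :> R.
Proof. by rewrite expf_neq0 // pnatr_eq0. Qed.

Lemma dyadic_int (m : int) : dyadic m%:~R.
Proof. by exists m, 0%N; rewrite expr0 divr1. Qed.

Lemma dyadicD x y : dyadic x -> dyadic y -> dyadic (x + y).
Proof.
move=> [m [n ->]] [m' [n' ->]]; exists (m * 2 ^+ n' + m' * 2 ^+ n), (n + n')%N.
rewrite exprD intrD !intrM !rmorphXn /=.
by have := exp2_neq0 n; have := exp2_neq0 n' => h h'; field; rewrite h h'.
Qed.

Lemma dyadicM x y : dyadic x -> dyadic y -> dyadic (x * y).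
Proof.
move=> [m [n ->]] [m' [n' ->]]; exists (m * m'), (n + n')%N.
by rewrite exprD intrM invfM mulrACA.
Qed.

Lemma dyadicN x : dyadic x -> dyadic (- x).
Proof. by move=> [m [n ->]]; exists (- m), n; rewrite mulrNz mulNr. Qed.

Lemma dyadicB x y : dyadic x -> dyadic y -> dyadic (x - y).
Proof. by move=> dx dy; apply: dyadicD => //; exact: dyadicN. Qed.

Lemma dyadic_exp2 (k : int) : dyadic (2 ^ k).
Proof.
case: k => n; first by exists (2 ^+ n), 0%N; rewrite expr0 divr1 rmorphXn.
by exists 1, n.+1; rewrite mul1r.
Qed.

End Dyadic.

Section Thompson.
Context {R : realType}.
Implicit Types (g h : R -> R) (x y u v : R).

Definition inverse_homeos01 g h : Prop :=
  [/\ {homo g : x / x \in `[0, 1]}, {homo h : x / x \in `[0, 1]},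
      {within `[0, 1], continuous g}, {within `[0, 1], continuous h} &
      {in `[0, 1], cancel g h} /\ {in `[0, 1], cancel h g}].

Definition homeo01 g : Prop := exists h, inverse_homeos01 g h.

Definition orientation_preserving01 g : Prop :=
  {in `[0, 1] &, {homo g : x y / x < y}}.

(* [B] is allowed to contain points that are not breakpoints of [g]. *)
Definition dyadic_piecewise_linear01 g : Prop :=
  exists2 B : seq R, (forall b, b \in B -> dyadic b) &
    forall u v, 0 <= u -> u <= v -> v <= 1 ->
      (forall b, b \in B -> ~~ (u < b < v)) ->
      exists (k : int) (c : R), forall x, u <= x <= v -> g x = 2 ^ k * x + c.

(* Self-homeomorphisms of [0, 1] are represented by their extension by the
   identity to the real line, so that equality of functions is equality on
   [0, 1]. *)
Definition is_thompson g : Prop :=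
  [/\ homeo01 g, orientation_preserving01 g, dyadic_piecewise_linear01 g &
      forall x, x \notin `[0, 1] -> g x = x].

Lemma increasing_bijection01 g h :
  {homo g : x / x \in `[0, 1]} -> {homo h : x / x \in `[0, 1]} ->
  {in `[0, 1], cancel h g} -> orientation_preserving01 g ->
  [/\ g 0 = 0, g 1 = 1, {in `[0, 1] &, {mono g : x y / x <= y}} &
      {within `[0, 1], continuous g}].
Proof.
move=> gI hI hK ginc.
have i0 : 0 \in `[0, 1 : R] by rewrite bound_itvE.
have i1 : 1 \in `[0, 1 : R] by rewrite bound_itvE.
have gle := le_mono_in ginc.
have g0 : g 0 = 0.
  apply/eqP; rewrite eq_le; have /= -> := itvP (gI _ i0); rewrite andbT.
  by rewrite -[leRHS](hK 0 i0) gle ?hI// (itvP (hI _ i0)).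
have g1 : g 1 = 1.
  apply/eqP; rewrite eq_le; have /= -> := itvP (gI _ i1).
  by rewrite -[leLHS](hK 1 i1) gle ?hI// (itvP (hI _ i1)).
split=> //; apply: segment_inc_surj_continuous => // y.
by rewrite g0 g1 => yI; exists (h y); [exact: hI | exact: hK].
Qed.

Lemma homeo01_intro g h :
  {homo g : x / x \in `[0, 1]} -> {homo h : x / x \in `[0, 1]} ->
  {in `[0, 1], cancel g h} -> {in `[0, 1], cancel h g} ->
  orientation_preserving01 g -> homeo01 g /\ orientation_preserving01 h.
Proof.
move=> gI hI gK hK ginc.
have [_ _ gle gc] := increasing_bijection01 gI hI hK ginc.
have hinc : orientation_preserving01 h.
  by move=> x y xI yI xy; rewrite -(leW_mono_in gle) ?hI// !hK.
have [_ _ _ hc] := increasing_bijection01 hI gI gK hinc.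
by split=> //; exists h.
Qed.

Lemma is_thompson_id : is_thompson idfun.
Proof.
split=> //; last first.
  by exists [::] => // u v _ _ _ _; exists 0, 0 => x _; rewrite expr0z mul1r addr0.
by have [] := @homeo01_intro idfun idfun.
Qed.

Lemma dyadic_increment g u v : dyadic_piecewise_linear01 g ->
  0 <= u -> u <= v -> v <= 1 -> dyadic u -> dyadic v -> dyadic (g v - g u).
Proof.
move=> [B dB hB].
have [n] := ubnP (size [seq b <- B | u < b < v]).
elim: n u v => // n IH u v hn u0 uv v1 du dv.
have [/hasP [b bB /andP[ub bv]]|/hasPn hno] := boolP (has (fun b => u < b < v) B).
  have lt w z : u <= w -> z <= v -> ~~ (w < b < z) ->
      (size [seq b <- B | (w < b < z)%R] < n)%N.
    move=> uw zv wbz; rewrite -ltnS; apply: leq_trans hn.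
    have -> : [seq c <- B | w < c < z] =
        [seq c <- [seq c <- B | u < c < v] | w < c < z].
      rewrite -filter_predI; apply: eq_filter => c /=; apply/idP/idP => [|/andP[]//].
      by move=> /andP[wc cz]; rewrite wc cz (le_lt_trans uw wc) (lt_le_trans cz zv).
    rewrite size_filter ltnS ltn_neqAle count_size andbT -all_count.
    by apply/allPn; exists b => //; rewrite mem_filter ub bv.
  have -> : g v - g u = (g v - g b) + (g b - g u) by ring.
  apply: dyadicD; apply: IH => //; try exact: ltW; try exact: dB.
  - by apply: lt => //; [exact: ltW | rewrite ltxx].
  - exact: le_trans u0 (ltW ub).
  - by apply: lt => //; [exact: ltW | rewrite ltxx andbF].
  - exact: le_trans (ltW bv) v1.
have [k [c gE]] := hB u v u0 uv v1 hno.
rewrite !gE ?lexx ?uv //.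
have -> : 2 ^ k * v + c - (2 ^ k * u + c) = 2 ^ k * (v - u) by ring.
by apply: dyadicM; [exact: dyadic_exp2 | exact: dyadicB].
Qed.

Lemma is_thompson_inverse g : is_thompson g ->
  exists h, [/\ is_thompson h, cancel g h & cancel h g].
Proof.
move=> [[h0 [gI h0I _ _ [gK0 hK0]]] ginc gpl gout].
pose h x := if x \in `[0, 1] then h0 x else x.
have hI : {homo h : x / x \in `[0, 1]} by move=> x xI; rewrite /h xI h0I.
have gK1 : {in `[0, 1], cancel g h} by move=> x xI; rewrite /h gI// gK0.
have hK1 : {in `[0, 1], cancel h g} by move=> x xI; rewrite /h xI hK0.
have hout x : x \notin `[0, 1] -> h x = x by rewrite /h => /negbTE ->.
have [_ hinc] := homeo01_intro gI hI gK1 hK1 ginc.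
have [hh _] := homeo01_intro hI gI hK1 gK1 hinc.
have gK : cancel g h.
  move=> x; have [/gK1//|xI] := boolP (x \in `[0, 1]).
  by rewrite gout// hout.
have hK : cancel h g.
  move=> x; have [/hK1//|xI] := boolP (x \in `[0, 1]).
  by rewrite hout// gout.
have [g0 g1 gle _] := increasing_bijection01 gI hI hK1 ginc.
have [_ _ hle _] := increasing_bijection01 hI gI gK1 hinc.
exists h; split=> //; split=> //.
case: (gpl) => B dB hB; exists [seq g b | b <- B].
  move=> _ /mapP[b bB ->].
  have [bI|bI] := boolP (b \in `[0, 1]); last by rewrite gout//; exact: dB.
  rewrite -[g b]subr0 -g0; apply: dyadic_increment => //; rewrite ?(itvP bI)//.
    by have := dyadic_int (R := R) 0.
  exact: dB.
move=> u v u0 uv v1 nB.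
have uI : u \in `[0, 1] by rewrite in_itv/= u0 (le_trans uv v1).
have vI : v \in `[0, 1] by rewrite in_itv/= v1 (le_trans u0 uv).
have huI := hI _ uI; have hvI := hI _ vI.
have huv : h u <= h v by rewrite hle.
have [||b bB|k [c gE]] := hB (h u) (h v) _ huv; rewrite ?(itvP huI) ?(itvP hvI)//.
  apply/negP => /andP[ub bv].
  have bI : b \in `[0, 1].
    rewrite in_itv/= (le_trans _ (ltW ub)) ?(itvP huI)//.
    by rewrite (le_trans (ltW bv)) ?(itvP hvI).
  have /negP := nB (g b) (map_f g bB); apply; rewrite -[u]hK -[v]hK.
  by rewrite !ginc.
exists (- k), (- (2 ^ (- k) * c)) => y /andP[uy yv].
have yI : y \in `[0, 1] by rewrite in_itv/= (le_trans u0 uy) (le_trans yv v1).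
have := gE (h y); rewrite hK => yE.
rewrite [in RHS]yE; last by rewrite !hle// uy yv.
rewrite mulrDr mulrA -expfzDr ?pnatr_eq0// addNr expr0z mul1r; ring.
Qed.

Lemma is_thompson_comp g1 g2 :
  is_thompson g1 -> is_thompson g2 -> is_thompson (g1 \o g2).
Proof.
move=> t1 t2.
have [h1 [[[_ [h1I _ _ _ _]] _ _ _] gK1 hK1]] := is_thompson_inverse t1.
have [h2 [t2' gK2 hK2]] := is_thompson_inverse t2.
case: (t2') => [[_ [h2I _ _ _ _]] h2inc h2pl h2out].
case: t1 => [[_ [g1I _ _ _ _]] g1inc [B1 dB1 hB1] g1out].
case: t2 => [[_ [g2I _ _ _ _]] g2inc [B2 dB2 hB2] g2out].
have ginc : orientation_preserving01 (g1 \o g2).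
  by move=> x y xI yI xy /=; rewrite g1inc ?g2I// g2inc.
split=> //; last by move=> x xI /=; rewrite g2out// g1out.
  apply: (proj1 (@homeo01_intro _ (h2 \o h1) _ _ _ _ ginc)) => x xI /=;
    by rewrite ?g1I ?g2I ?h2I ?h1I// ?gK1 ?gK2 ?hK2 ?hK1.
have [h20 _ _ _] := increasing_bijection01 h2I g2I (in1W gK2) h2inc.
have [_ _ g2le _] := increasing_bijection01 g2I h2I (in1W hK2) g2inc.
exists (B2 ++ [seq h2 b | b <- B1]).
  move=> c; rewrite mem_cat => /orP[/dB2//|/mapP[b bB ->]].
  have [bI|bI] := boolP (b \in `[0, 1]); last by rewrite h2out//; exact: dB1.
  rewrite -[h2 b]subr0 -h20; apply: dyadic_increment => //; rewrite ?(itvP bI)//.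
    by have := dyadic_int (R := R) 0.
  exact: dB1.
move=> u v u0 uv v1 nB.
have uI : u \in `[0, 1] by rewrite in_itv/= u0 (le_trans uv v1).
have vI : v \in `[0, 1] by rewrite in_itv/= v1 (le_trans u0 uv).
have guI := g2I _ uI; have gvI := g2I _ vI.
have guv : g2 u <= g2 v by rewrite g2le.
have [b bB|k2 [c2 g2E]] := hB2 u v u0 uv v1.
  by apply: nB; rewrite mem_cat bB.
have [||b bB|k1 [c1 g1E]] := hB1 (g2 u) (g2 v) _ guv;
    rewrite ?(itvP guI) ?(itvP gvI)//.
  apply/negP => /andP[ub bv].
  have bI : b \in `[0, 1].
    rewrite in_itv/= (le_trans _ (ltW ub)) ?(itvP guI)//.
    by rewrite (le_trans (ltW bv)) ?(itvP gvI).
  have mb : h2 b \in B2 ++ [seq h2 b | b <- B1] by rewrite mem_cat map_f ?orbT.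
  have /negP := nB _ mb; apply.
  by rewrite -[u]gK2 -[v]gK2 !h2inc.
exists (k1 + k2), (2 ^ k1 * c2 + c1) => x /andP[ux xv] /=.
have xI : x \in `[0, 1] by rewrite in_itv/= (le_trans u0 ux) (le_trans xv v1).
rewrite g1E ?g2le ?ux ?xv// g2E ?ux ?xv// expfzDr ?pnatr_eq0//; ring.
Qed.

End Thompson.

Record thompson (R : realType) := Thompson {
  thompson_fun :> R -> R;
  thompson_subproof : `[< is_thompson thompson_fun >]
}.
HB.instance Definition _ (R : realType) :=
  [isSub for @thompson_fun R].
HB.instance Definition _ (R : realType) := [Choice of thompson R by <:].

Section ThompsonGroup.
Context {R : realType}.
Implicit Types g h : thompson R.

Lemma thompsonP g : is_thompson g.
Proof. exact/asboolP/thompson_subproof. Qed.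

Lemma thompson_ext g h : g =1 h -> g = h.
Proof. by move=> gh; apply/val_inj/funext. Qed.

Definition mk_thompson (g : R -> R) (tg : is_thompson g) : thompson R :=
  Thompson (asboolT tg).

Definition thompson_one : thompson R := mk_thompson is_thompson_id.

Definition thompson_mul g h : thompson R :=
  mk_thompson (is_thompson_comp (thompsonP g) (thompsonP h)).

Let thompson_inv_sig g := cid (is_thompson_inverse (thompsonP g)).

Lemma thompson_inv_subproof g : is_thompson (sval (thompson_inv_sig g)).
Proof. by case: (svalP (thompson_inv_sig g)). Qed.

Definition thompson_inv g : thompson R := mk_thompson (thompson_inv_subproof g).

Lemma thompson_invK g : cancel g (thompson_inv g) /\ cancel (thompson_inv g) g.
Proof. by case: (svalP (thompson_inv_sig g)). Qed.

Lemma thompson_mulA : associative thompson_mul.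
Proof. by move=> g h k; apply: thompson_ext. Qed.

Lemma thompson_mul1 : left_id thompson_one thompson_mul.
Proof. by move=> g; apply: thompson_ext. Qed.

Lemma thompson_mulr1 : right_id thompson_one thompson_mul.
Proof. by move=> g; apply: thompson_ext. Qed.

Lemma thompson_mulV : left_inverse thompson_one thompson_inv thompson_mul.
Proof. by move=> g; apply: thompson_ext; exact: (proj1 (thompson_invK g)). Qed.

Lemma thompson_mulrV : right_inverse thompson_one thompson_inv thompson_mul.
Proof. by move=> g; apply: thompson_ext; exact: (proj2 (thompson_invK g)). Qed.

End ThompsonGroup.

HB.instance Definition _ (R : realType) := isGroup.Build (thompson R)
  thompson_mulA thompson_mul1 thompson_mulr1 thompson_mulV thompson_mulrV.

Record dyadic01 (R : realType) := Dyadic01 {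
  dyadic01_val :> R;
  dyadic01_subproof : `[< dyadic dyadic01_val >] && (0 < dyadic01_val < 1)
}.
HB.instance Definition _ (R : realType) := [isSub for @dyadic01_val R].
HB.instance Definition _ (R : realType) := [Choice of dyadic01 R by <:].

Section Action.
Context {R : realType}.
Implicit Types (g h : thompson R) (x : dyadic01 R) (E : {fset dyadic01 R}).

Lemma root_point_subproof : `[< dyadic (5 / 8 : R) >] && (0 < (5 / 8 : R) < 1).
Proof.
apply/andP; split; last lra.
by apply/asboolP; exists 5, 3%N; congr (_ / _); rewrite -natrX.
Qed.

Definition root_point : dyadic01 R := Dyadic01 root_point_subproof.

Lemma thompson_act_subproof g x :
  `[< dyadic (g x) >] && (0 < g x < 1).
Proof.
have /andP[/asboolP dx /andP[x0 x1]] := dyadic01_subproof x.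
have [[h [gI hI _ _ [gK hK]]] ginc gpl _] := thompsonP g.
have [g0 g1 _ _] := increasing_bijection01 gI hI hK ginc.
have xI : (x : R) \in `[0, 1] by rewrite in_itv/= !ltW.
apply/andP; split; last by rewrite -g0 -g1; apply/andP; split; apply: ginc; rewrite ?bound_itvE.
apply/asboolP; rewrite -[g x]subr0 -g0.
exact: (dyadic_increment gpl (lexx 0) (ltW x0) (ltW x1) (dyadic_int 0) dx).
Qed.

Definition thompson_act g x : dyadic01 R := Dyadic01 (thompson_act_subproof g x).

Lemma thompson_act1 x : thompson_act 1%g x = x.
Proof. exact: val_inj. Qed.

Lemma thompson_actM g h x :
  thompson_act (g * h)%g x = thompson_act g (thompson_act h x).
Proof. exact: val_inj. Qed.

Lemma thompson_actK g : cancel (thompson_act g) (thompson_act g^-1%g).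
Proof. by move=> x; rewrite -thompson_actM mulVg thompson_act1. Qed.

Lemma thompson_actKV g : cancel (thompson_act g^-1%g) (thompson_act g).
Proof. by move=> x; rewrite -thompson_actM mulgV thompson_act1. Qed.

Definition thompson_image g E : {fset dyadic01 R} := [fset thompson_act g x | x in E].

Lemma in_thompson_image g E x : (x \in thompson_image g E) = (thompson_act g^-1%g x \in E).
Proof.
apply/imfsetP/idP => [[y yE ->]|xE]; first by rewrite thompson_actK.
by exists (thompson_act g^-1%g x); rewrite ?thompson_actKV.
Qed.

End Action.

Definition symdiff (T : choiceType) (A B : {fset T}) : {fset T} :=
  ((A `\` B) `|` (B `\` A))%fset.

Lemma in_symdiff (T : choiceType) (A B : {fset T}) x :
  (x \in symdiff A B) = (x \in A) (+) (x \in B).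
Proof. by rewrite !inE; case: (x \in A); case: (x \in B). Qed.

(* The semidirect product of the finite sets of dyadic points of (0, 1), under
   symmetric difference, by Thompson's group; a record rather than a pair, so
   as not to inherit the direct product structure. *)
Record lamplighter (R : realType) := Lamplighter {
  lamp_set : {fset dyadic01 R};
  lamp_shift : thompson R
}.

Section LamplighterGroup.
Context {R : realType}.
Implicit Types (u v w : lamplighter R) (E : {fset dyadic01 R}).

Definition pair_of_lamplighter u := (lamp_set u, lamp_shift u).
Definition lamplighter_of_pair p : lamplighter R := Lamplighter p.1 p.2.
Lemma pair_of_lamplighterK : cancel pair_of_lamplighter lamplighter_of_pair.
Proof. by case. Qed.

Definition lamplighter_one : lamplighter R := Lamplighter fset0 1%g.

Definition lamplighter_mul u v : lamplighter R :=
  Lamplighter (symdiff (lamp_set u) (thompson_image (lamp_shift u) (lamp_set v)))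
              (lamp_shift u * lamp_shift v)%g.

Definition lamplighter_inv u : lamplighter R :=
  Lamplighter (thompson_image (lamp_shift u)^-1%g (lamp_set u)) (lamp_shift u)^-1%g.

Lemma lamplighter_mulA : associative lamplighter_mul.
Proof.
move=> u v w; congr Lamplighter; last by rewrite mulgA.
apply/fsetP => x; rewrite !(in_symdiff, in_thompson_image) addbA.
by rewrite invgM thompson_actM.
Qed.

Lemma lamplighter_mul1 : left_id lamplighter_one lamplighter_mul.
Proof.
case=> E g; congr Lamplighter; last by rewrite mul1g.
by apply/fsetP => x; rewrite in_symdiff in_thompson_image invg1 thompson_act1 inE.
Qed.

Lemma lamplighter_mulr1 : right_id lamplighter_one lamplighter_mul.
Proof.
case=> E g; congr Lamplighter; last by rewrite mulg1.
by apply/fsetP => x; rewrite in_symdiff in_thompson_image inE addbF.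
Qed.

Lemma lamplighter_mulV : left_inverse lamplighter_one lamplighter_inv lamplighter_mul.
Proof.
case=> E g; congr Lamplighter; last by rewrite mulVg.
by apply/fsetP => x; rewrite in_symdiff !in_thompson_image inE addbb.
Qed.

Lemma lamplighter_mulrV : right_inverse lamplighter_one lamplighter_inv lamplighter_mul.
Proof.
case=> E g; congr Lamplighter; last by rewrite mulgV.
apply/fsetP => x; rewrite in_symdiff !in_thompson_image invgK thompson_actKV inE.
exact: addbb.
Qed.

Definition lamplighter_act u E : {fset dyadic01 R} :=
  symdiff (lamp_set u) (thompson_image (lamp_shift u) E).

End LamplighterGroup.

HB.instance Definition _ (R : realType) :=
  Choice.copy (lamplighter R) (can_type (@pair_of_lamplighterK R)).
HB.instance Definition _ (R : realType) := isGroup.Build (lamplighter R)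
  lamplighter_mulA lamplighter_mul1 lamplighter_mulr1 lamplighter_mulV
  lamplighter_mulrV.

Lemma lamplighter_act1 (R : realType) (E : {fset dyadic01 R}) :
  lamplighter_act 1%g E = E.
Proof.
by apply/fsetP => x; rewrite in_symdiff in_thompson_image invg1 thompson_act1 inE.
Qed.

Lemma lamplighter_actM (R : realType) (u v : lamplighter R)
    (E : {fset dyadic01 R}) :
  lamplighter_act (u * v)%g E = lamplighter_act u (lamplighter_act v E).
Proof.
apply/fsetP => x; rewrite !(in_symdiff, in_thompson_image) addbA.
by rewrite invgM thompson_actM.
Qed.

Section Generators.
Context {R : realType}.

Definition a_fun (x : R) : R :=
  if x < 0 then x
  else if x <= 1 / 4 then 2 * x
  else if x <= 3 / 4 then x / 2 + 3 / 8
  else x.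

Definition b_fun (x : R) : R :=
  if x <= 1 / 2 then x
  else if x <= 3 / 4 then x / 2 + 1 / 4
  else if x <= 7 / 8 then x - 1 / 8
  else if x <= 1 then 2 * x - 1
  else x.

Let a_inv (x : R) : R :=
  if x <= 1 / 2 then x / 2 else if x <= 3 / 4 then 2 * x - 3 / 4 else x.

Let b_inv (x : R) : R :=
  if x <= 1 / 2 then x
  else if x <= 5 / 8 then 2 * x - 1 / 2
  else if x <= 3 / 4 then x + 1 / 8
  else (x + 1) / 2.

Lemma a_funE x : [/\ 0 <= x <= 1 / 4 -> a_fun x = 2 * x,
  1 / 4 <= x <= 3 / 4 -> a_fun x = x / 2 + 3 / 8 & 3 / 4 <= x -> a_fun x = x].
Proof.
by split=> [/andP[x0 x1]|/andP[x0 x1]|x0]; rewrite /a_fun;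
  repeat case: ifPn => ?; lra.
Qed.

Lemma b_funE x : [/\ x <= 1 / 2 -> b_fun x = x,
  1 / 2 <= x <= 3 / 4 -> b_fun x = x / 2 + 1 / 4,
  3 / 4 <= x <= 7 / 8 -> b_fun x = x - 1 / 8 &
  7 / 8 <= x <= 1 -> b_fun x = 2 * x - 1].
Proof.
by split=> [x0|/andP[x0 x1]|/andP[x0 x1]|/andP[x0 x1]]; rewrite /b_fun;
  repeat case: ifPn => ?; lra.
Qed.

Let a_invE x : [/\ x <= 1 / 2 -> a_inv x = x / 2,
  1 / 2 <= x <= 3 / 4 -> a_inv x = 2 * x - 3 / 4 & 3 / 4 <= x -> a_inv x = x].
Proof.
by split=> [x0|/andP[x0 x1]|x0]; rewrite /a_inv; repeat case: ifPn => ?; lra.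
Qed.

Let b_invE x : [/\ x <= 1 / 2 -> b_inv x = x,
  1 / 2 <= x <= 5 / 8 -> b_inv x = 2 * x - 1 / 2,
  5 / 8 <= x <= 3 / 4 -> b_inv x = x + 1 / 8 &
  3 / 4 <= x -> b_inv x = (x + 1) / 2].
Proof.
by split=> [x0|/andP[x0 x1]|/andP[x0 x1]|x0]; rewrite /b_inv;
  repeat case: ifPn => ?; lra.
Qed.

Let in01 x : (x \in `[0, 1 : R]) = (0 <= x <= 1).
Proof. by rewrite in_itv. Qed.

Let a_inc : orientation_preserving01 a_fun.
Proof.
move=> x y; rewrite !in01 => /andP[x0 x1] /andP[y0 y1] xy; rewrite /a_fun.
by repeat case: ifPn => ?; lra.
Qed.

Let b_inc : orientation_preserving01 b_fun.
Proof.
move=> x y; rewrite !in01 => /andP[x0 x1] /andP[y0 y1] xy; rewrite /b_fun.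
by repeat case: ifPn => ?; lra.
Qed.

Let a_homeo : homeo01 a_fun.
Proof.
suff [] : homeo01 a_fun /\ orientation_preserving01 a_inv by [].
apply: homeo01_intro => // x; rewrite !in01 => /andP[x0 x1].
- by rewrite /a_fun; repeat case: ifPn => ?; lra.
- by rewrite /a_inv; repeat case: ifPn => ?; lra.
- have [E1 E2 E3] := a_funE x; have [F1 F2 F3] := a_invE (a_fun x).
  have [x4|x4] := lerP x (1 / 4).
    by move: F1; rewrite E1 ?x0// => -> ; lra.
  have [x34|x34] := lerP x (3 / 4).
    by move: F2; rewrite E2 ?(ltW x4)// => ->; lra.
  by move: F3; rewrite E3 ?ltW// => ->//; exact: ltW.
- have [E1 E2 E3] := a_invE x; have [F1 F2 F3] := a_funE (a_inv x).
  have [x4|x4] := lerP x (1 / 2).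
    by move: F1; rewrite E1 // => ->; lra.
  have [x34|x34] := lerP x (3 / 4).
    by move: F2; rewrite E2 ?(ltW x4)// => ->; lra.
  by move: F3; rewrite E3 ?ltW// => ->//; exact: ltW.
Qed.

Let b_homeo : homeo01 b_fun.
Proof.
suff [] : homeo01 b_fun /\ orientation_preserving01 b_inv by [].
apply: homeo01_intro => // x; rewrite !in01 => /andP[x0 x1].
- by rewrite /b_fun; repeat case: ifPn => ?; lra.
- by rewrite /b_inv; repeat case: ifPn => ?; lra.
- have [E1 E2 E3 E4] := b_funE x; have [F1 F2 F3 F4] := b_invE (b_fun x).
  have [x2|x2] := lerP x (1 / 2); first by move: F1; rewrite E1 // => ->.
  have [x34|x34] := lerP x (3 / 4).
    by move: F2; rewrite E2 ?(ltW x2)// => ->; lra.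
  have [x78|x78] := lerP x (7 / 8).
    by move: F3; rewrite E3 ?(ltW x34)// => ->; lra.
  by move: F4; rewrite E4 ?(ltW x78)// => ->; lra.
- have [E1 E2 E3 E4] := b_invE x; have [F1 F2 F3 F4] := b_funE (b_inv x).
  have [x2|x2] := lerP x (1 / 2); first by move: F1; rewrite E1 // => ->.
  have [x58|x58] := lerP x (5 / 8).
    by move: F2; rewrite E2 ?(ltW x2)// => ->; lra.
  have [x34|x34] := lerP x (3 / 4).
    by move: F3; rewrite E3 ?(ltW x58)// => ->; lra.
  by move: F4; rewrite E4 ?(ltW x34)// => ->; lra.
Qed.

Let no_break (u v b : R) (B : seq R) :
  (forall c, c \in B -> ~~ (u < c < v)) -> b \in B -> b < v -> b <= u.
Proof. by move=> nB /nB; rewrite negb_and -!leNgt => /orP[//|]; case: ltgtP. Qed.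

Lemma is_thompson_a : is_thompson a_fun.
Proof.
split=> //; last first.
  move=> x; rewrite in01 negb_and -!ltNge /a_fun => h.
  by repeat case: ifPn => ?; lra.
exists [:: 1 / 4; 3 / 4].
  move=> b; rewrite !inE => /orP[] /eqP ->.
    by exists 1, 2%N; congr (_ / _); rewrite -natrX.
  by exists 3, 2%N; congr (_ / _); rewrite -natrX.
move=> u v u0 uv v1 nB.
have nb b := no_break (b := b) nB.
have [v4|/nb u4] := lerP v (1 / 4).
  exists 1, 0 => x /andP[ux xv]; have [E _ _] := a_funE x.
  by rewrite expr1z addr0 E// (le_trans u0 ux) (le_trans xv v4).
have [v34|/nb u34] := lerP v (3 / 4).
  exists (- 1), (3 / 8) => x /andP[ux xv]; have [_ E _] := a_funE x.
  rewrite -invr_expz expr1z mulrC E// (le_trans _ ux) ?(le_trans xv v34)//.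
  by rewrite u4// inE eqxx.
exists 0, 0 => x /andP[ux xv]; have [_ _ E] := a_funE x.
by rewrite expr0z mul1r addr0 E// (le_trans _ ux)// u34// !inE eqxx orbT.
Qed.

Lemma is_thompson_b : is_thompson b_fun.
Proof.
split=> //; last first.
  move=> x; rewrite in01 negb_and -!ltNge /b_fun => h.
  by repeat case: ifPn => ?; lra.
exists [:: 1 / 2; 3 / 4; 7 / 8].
  move=> b; rewrite !inE => /or3P[] /eqP ->.
  - by exists 1, 1%N; rewrite expr1.
  - by exists 3, 2%N; congr (_ / _); rewrite -natrX.
  - by exists 7, 3%N; congr (_ / _); rewrite -natrX.
move=> u v u0 uv v1 nB.
have nb b := no_break (b := b) nB.
have [v2|/nb u2] := lerP v (1 / 2).
  exists 0, 0 => x /andP[ux xv]; have [E _ _ _] := b_funE x.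
  by rewrite expr0z mul1r addr0 E// (le_trans xv v2).
have [v34|/nb u34] := lerP v (3 / 4).
  exists (- 1), (1 / 4) => x /andP[ux xv]; have [_ E _ _] := b_funE x.
  rewrite -invr_expz expr1z mulrC E// (le_trans _ ux) ?(le_trans xv v34)//.
  by rewrite u2// inE eqxx.
have [v78|/nb u78] := lerP v (7 / 8).
  exists 0, (- (1 / 8)) => x /andP[ux xv]; have [_ _ E _] := b_funE x.
  rewrite expr0z mul1r E// (le_trans _ ux) ?(le_trans xv v78)//.
  by rewrite u34// !inE eqxx orbT.
exists 1, (- 1) => x /andP[ux xv]; have [_ _ _ E] := b_funE x.
rewrite expr1z E// (le_trans _ ux) ?(le_trans xv v1)//.
by rewrite u78// !inE eqxx !orbT.
Qed.

Definition gen_a : thompson R := mk_thompson is_thompson_a.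
Definition gen_b : thompson R := mk_thompson is_thompson_b.

Implicit Type phi : dyadic01 R -> R.

Definition superharmonic phi : Prop := forall x,
  4^-1 * (phi (thompson_act gen_a x) + phi (thompson_act gen_b x)
        + phi (thompson_act gen_a^-1%g x) + phi (thompson_act gen_b^-1%g x))
  <= phi x.

Definition min_function phi (E : {fset dyadic01 R}) : R :=
  if enum_fset E is x :: s then \big[Num.min/phi x]_(y <- s) phi y
  else phi root_point.

Lemma min_function0 phi : min_function phi fset0 = phi root_point.
Proof.
rewrite /min_function; case e : (enum_fset fset0) => [//|x s].
have : x \in enum_fset (fset0 : {fset dyadic01 R}) by rewrite e mem_head.
by rewrite -[_ \in _]/(x \in fset0) inE.
Qed.

Lemma min_functionP phi (E : {fset dyadic01 R}) : E != fset0 ->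
  (exists2 x, x \in E & min_function phi E = phi x) /\
  (forall x, x \in E -> min_function phi E <= phi x).
Proof.
move=> E0; have Ee x : (x \in E) = (x \in enum_fset E) by [].
rewrite /min_function; case e : (enum_fset E) => [|x s].
  by case/fset0Pn: E0 => x; rewrite Ee e.
split; last first.
  move=> y; rewrite Ee e inE => /orP[/eqP ->|ys].
    exact: bigmin_le_id.
  by apply: bigmin_inf_seq ys _ _.
have : exists2 y, y \in x :: s & \big[Num.min/phi x]_(y <- s) phi y = phi y.
  elim: s {e} => [|z s [y ys IH]]; first by exists x; rewrite ?big_nil ?mem_head.
  rewrite big_cons IH minEle; case: ifP => _.
    by exists z => //; rewrite !inE eqxx orbT.
  by exists y => //; move: ys; rewrite !inE => /orP[->//|->]; rewrite !orbT.
by case=> y ys h; exists y; rewrite ?Ee ?e.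
Qed.

End Generators.

(* Main.v *)
(* Near 0 the generator a acts as x |-> 2x and b acts trivially, so along a ray
   w, w/2, w/4, ... with w <= 1/2 a superharmonic function is a concave sequence
   u.  If it is nonnegative, u is nondecreasing and u_m / m is nonincreasing,
   hence u_(n + p) / u_n -> 1 for fixed p, at a rate independent of u.  Every
   element of F acts near 0 as multiplication by a power of 2, i.e. as a shift
   along rays.  Since superharmonicity gives phi(sx) - inf phi <= 4 (phi(x) -
   inf phi) for every generator s, a point where phi_i is close enough to its
   infimum can be moved to depth n of a ray while keeping phi_i within 1/(n+1)
   of the infimum.  E_n collects one such point for each i: translating it by F
   changes each f_i by a factor close to 1, any fixed finite set is eventually
   disjoint from E_n, and the values of phi_i on such a set are eventually
   almost at least f_i(E_n), so adding it to E_n is harmless. *)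
Require Import Defs.
From mathcomp Require Import all_boot all_order all_algebra.
From mathcomp Require Import finmap.
From mathcomp Require Import all_classical all_reals all_analysis.
From mathcomp Require Import lra.
Import numFieldNormedType.Exports.
Import Order.TTheory GRing.Theory Num.Theory.
Local Open Scope classical_set_scope.
Local Open Scope ring_scope.

(** * Nonnegative concave sequences *)

Section ConcaveSequences.
Context {R : realType}.
Implicit Type u : nat -> R.

Lemma concave_le_tangent u m l :
  (forall j, u j + u j.+2 <= 2 * u j.+1) ->
  u (m + l)%N <= u m + l%:R * (u m.+1 - u m).
Proof.
move=> u_concave.
have dec j : u (m + j).+1 - u (m + j)%N <= u m.+1 - u m.
  elim: j => [|j IH]; first by rewrite addn0.
  by have := u_concave (m + j)%N; rewrite addnS; lra.
elim: l => [|l IH]; first by rewrite addn0 mul0r addr0.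
by have := dec l; rewrite addnS -natr1; lra.
Qed.

(** By concavity a negative increment would persist, and by the Archimedean property it would push
    the sequence below 0. *)
Lemma concave_ge0_nondecreasing u m l : (forall j, 0 <= u j) ->
  (forall j, u j + u j.+2 <= 2 * u j.+1) -> u m <= u (m + l)%N.
Proof.
move=> u_ge0 u_concave.
have step j : u j <= u j.+1.
  rewrite leNgt; apply/negP => lt_u.
  have d_gt0 : 0 < u j - u j.+1 by rewrite subr_gt0.
  have := archi_boundP (divr_ge0 (u_ge0 j) (ltW d_gt0)).
  rewrite ltr_pdivrMr//; set n := Num.bound _ => hn.
  by have := concave_le_tangent u j n u_concave; have := u_ge0 (j + n)%N; lra.
by elim: l => [|l IH]; rewrite ?addn0// addnS (le_trans IH).
Qed.

(** Monotonicity of u_m / m, cleared of denominators so that m = 0 is allowed. *)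
Lemma concave_ge0_ratio u m l : (forall j, 0 <= u j) ->
  (forall j, u j + u j.+2 <= 2 * u j.+1) ->
  m%:R * u (m + l)%N <= (m + l)%:R * u m.
Proof.
move=> u_ge0 u_concave.
(* The tangent at [m], extended back to index 0, is nonnegative there. *)
have tangent0 : m%:R * (u m.+1 - u m) <= u m.
  elim: m => [|j IH]; first by rewrite mul0r.
  have := ler_wpM2l (ler0n R j.+1) (u_concave j).
  by rewrite -natr1; lra.
have := ler_wpM2l (ler0n R m) (concave_le_tangent u m l u_concave).
have := ler_wpM2l (ler0n R l) tangent0.
by rewrite natrD; lra.
Qed.

End ConcaveSequences.

(** * Rays tending to 0 and to 1, and concavity along them *)

Section Thompson.
Context {R : realType}.
Implicit Types (x y w : dyadic01 R) (g : thompson R) (phi : dyadic01 R -> R).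

Local Notation act_a := (thompson_act gen_a).
Local Notation act_b := (thompson_act gen_b).
Local Notation act_aV := (thompson_act gen_a^-1%g).
Local Notation act_bV := (thompson_act gen_b^-1%g).

Lemma dyadic01_gt0 x : 0 < (x : R).
Proof. by have /andP[_ /andP[]] := dyadic01_subproof x. Qed.

Lemma dyadic01_lt1 x : (x : R) < 1.
Proof. by have /andP[_ /andP[]] := dyadic01_subproof x. Qed.

Lemma thompson_act_fixedV g x :
  thompson_act g x = x -> thompson_act g^-1%g x = x.
Proof. by move=> gx; rewrite -{1}gx thompson_actK. Qed.

Lemma act_a_fixed x : 3 / 4 <= (x : R) -> act_a x = x.
Proof. by move=> x34; apply: val_inj; have [_ _ /(_ x34)] := a_funE (x : R). Qed.

Lemma act_b_fixed x : (x : R) <= 1 / 2 -> act_b x = x.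
Proof. by move=> x12; apply: val_inj; have [/(_ x12)] := b_funE (x : R). Qed.

Lemma act_aVE x : (x : R) <= 1 / 2 -> (act_aV x : R) = (x : R) / 2.
Proof.
move=> x12; have x0 := dyadic01_gt0 x.
have /(congr1 (@dyadic01_val R)) /= := thompson_actKV gen_a x.
by rewrite /a_fun; repeat case: ifPn => ?; lra.
Qed.

Lemma act_bVE x : 3 / 4 <= (x : R) -> (act_bV x : R) = ((x : R) + 1) / 2.
Proof.
move=> x34; have x1 := dyadic01_lt1 x; have y1 := dyadic01_lt1 (act_bV x).
have /(congr1 (@dyadic01_val R)) /= := thompson_actKV gen_b x.
by rewrite /b_fun; repeat case: ifPn => ?; lra.
Qed.

Lemma iter_act_aVE m w : (w : R) <= 1 / 2 ->
  (iter m act_aV w : R) = (w : R) / 2 ^+ m.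
Proof.
move=> w12; have w0 := dyadic01_gt0 w.
elim: m => [|m IH]; first by rewrite expr0 divr1.
have m1 : (2 ^- m : R) <= 1 by rewrite invf_le1 ?exprn_gt0 ?exprn_ege1 ?ler1n.
rewrite iterS act_aVE IH; first by rewrite exprSr invfM mulrA.
by rewrite (le_trans _ w12)// ler_piMr// ltW.
Qed.

Lemma iter_act_bV_ge m w : 3 / 4 <= (w : R) -> 3 / 4 <= (iter m act_bV w : R).
Proof. by move=> w34; elim: m => [//|m IH]; rewrite iterS act_bVE//; lra. Qed.

Lemma superharmonic_concave_ray0 phi w : superharmonic phi -> (w : R) <= 1 / 2 ->
  forall m, phi (iter m act_aV w) + phi (iter m.+2 act_aV w) <=
    2 * phi (iter m.+1 act_aV w).
Proof.
move=> sh w12 m; have := sh (iter m.+1 act_aV w).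
have y12 : (iter m.+1 act_aV w : R) <= 1 / 2.
  rewrite iter_act_aVE// (le_trans _ w12)// ler_piMr ?(ltW (dyadic01_gt0 w))//.
  by rewrite invf_le1 ?exprn_gt0 ?exprn_ege1 ?ler1n.
rewrite act_b_fixed// (thompson_act_fixedV _ _ (act_b_fixed _ y12)).
by rewrite !iterS thompson_actKV; lra.
Qed.

(** Near 1 the roles are exchanged: [a] acts trivially and b^-1 halves the distance to 1. *)
Lemma superharmonic_concave_ray1 phi w : superharmonic phi -> 3 / 4 <= (w : R) ->
  forall m, phi (iter m act_bV w) + phi (iter m.+2 act_bV w) <=
    2 * phi (iter m.+1 act_bV w).
Proof.
move=> sh w34 m; have := sh (iter m.+1 act_bV w).
have y34 := iter_act_bV_ge m.+1 _ w34.
rewrite act_a_fixed// (thompson_act_fixedV _ _ (act_a_fixed _ y34)).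
by rewrite !iterS thompson_actKV; lra.
Qed.

Lemma thompson_germ0 g : exists (p : nat) (e : R), 0 < e /\
  ((forall x : R, 0 <= x <= e -> g x = 2 ^+ p * x) \/
   (forall x : R, 0 <= x <= e -> g x = x / 2 ^+ p)).
Proof.
have [[h [gI hI _ _ [gK hK]]] ginc [B _ gB] _] := thompsonP g.
have [g0 _ _ _] := increasing_bijection01 gI hI hK ginc.
(* No point of [B] lies strictly between 0 and [e], so a single affine formula for [g] holds on
   [0, e]. *)
pose e := \big[Num.min/1]_(b <- B | 0 < b) b.
have e0 : 0 < e.
  by rewrite /e; elim/big_ind: _ => // x y ? ?; rewrite lt_min; apply/andP.
have e1 : e <= 1 by exact: bigmin_le_id.
have [b bB|k [c gE]] := gB 0 e (lexx 0) (ltW e0) e1.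
  apply/negP => /andP[b0]; rewrite ltNge => /negP; apply.
  exact: bigmin_inf_seq bB b0 (lexx b).
have c0 : c = 0 by have := gE 0; rewrite g0 lexx (ltW e0) => /(_ isT); lra.
move: gE; rewrite c0; case: k => k gE.
  by exists k, e; split => //; left => x /gE ->; rewrite addr0.
(* The constructor for negative integers encodes -(k + 1), hence the exponent [k.+1]. *)
by exists k.+1, e; split => //; right => x /gE ->; rewrite addr0 mulrC.
Qed.

(** Since [w < 1], the threshold for [n] is uniform in [w]; this matters because [w] will vary with
    [n]. *)
Lemma ray0_small (e : R) : 0 < e ->
  \forall n \near \oo, forall w, (w : R) <= 1 / 2 -> (iter n act_aV w : R) < e.
Proof.
move=> e0; near=> n => w w12.
rewrite iter_act_aVE//; apply: (@lt_trans _ _ (1 / 2 ^+ n)).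
  by rewrite ltr_pM2r ?invr_gt0 ?exprn_gt0// dyadic01_lt1.
near: n; exact: (near_infty_natSinv_expn_lt (PosNum e0)).
Unshelve. all: by end_near. Qed.

Lemma ray0_avoids_fset (E : {fset dyadic01 R}) :
  \forall n \near \oo, forall w, (w : R) <= 1 / 2 -> iter n act_aV w \notin E.
Proof.
pose e := \big[Num.min/1]_(x <- enum_fset E) (x : R).
have e0 : 0 < e.
  rewrite /e; elim/big_ind: _ => // [x y ? ?|x _]; last exact: dyadic01_gt0.
  by rewrite lt_min; apply/andP.
apply: filterS (ray0_small e e0) => n small w w12; apply/negP => wE.
have := small w w12; rewrite ltNge => /negP; apply.
exact: bigmin_inf_seq wE _ (lexx _).
Qed.

Lemma thompson_act_ray0 g : exists p : nat,
  \forall n \near \oo, (p <= n)%N /\ forall w, (w : R) <= 1 / 2 ->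
    thompson_act g (iter n act_aV w) = iter (n - p) act_aV w \/
    thompson_act g (iter n act_aV w) = iter (n + p) act_aV w.
Proof.
have [p [e [e0 gE]]] := thompson_germ0 g; exists p; near=> n.
have pn : (p <= n)%N by near: n; exact: nbhs_infty_ge.
split=> // w w12.
have xe : 0 <= (iter n act_aV w : R) <= e.
  rewrite ltW ?dyadic01_gt0//= ltW//; move: w w12.
  by near: n; exact: ray0_small.
case: gE => /(_ _ xe) gxE; [left|right]; apply: val_inj => /=;
  rewrite gxE !iter_act_aVE//.
  rewrite -{1}(subnK pn) exprD invfM mulrCA; congr (_ * _).
  by rewrite mulrCA mulfV ?mulr1// expf_neq0// pnatr_eq0.
by rewrite exprD invfM mulrA.
Unshelve. all: by end_near. Qed.

(** Monotonicity and the ratio bound give a relative change of at most p / n for both shifts. The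
    threshold for [n] depends on [g] alone. *)
Lemma superharmonic_act_ray0 g : exists p : nat, \forall n \near \oo,
  forall phi, superharmonic phi -> (forall x, 0 <= phi x) ->
  forall w, (w : R) <= 1 / 2 ->
    n%:R * `|phi (thompson_act g (iter n act_aV w)) - phi (iter n act_aV w)|
      <= p%:R * phi (iter n act_aV w).
Proof.
have [p gE] := thompson_act_ray0 g; exists p.
apply: filterS gE => n [pn gE] phi sh phi0 w w12.
pose u m := phi (iter m act_aV w).
have u0 m : 0 <= u m by exact: phi0.
have uc := superharmonic_concave_ray0 phi w sh w12.
have um m l := concave_ge0_nondecreasing u m l u0 uc.
have ur m l := concave_ge0_ratio u m l u0 uc.
have [-> | ->] := gE w w12; rewrite -/(u _) -/(u n).
  have := um (n - p)%N p; have := ur (n - p)%N p.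
  rewrite subnK// natrB// => h1 h2; rewrite ler0_norm ?subr_le0//; lra.
have := um n p; have := ur n p; rewrite natrD => h1 h2.
by rewrite ger0_norm ?subr_ge0//; lra.
Qed.

(** * Almost minimal values deep inside a ray to 0 *)

Lemma superharmonic_harnack phi (c : R) : superharmonic phi ->
  (forall x, c <= phi x) -> forall x,
  phi (act_b x) - c <= 4 * (phi x - c) /\ phi (act_aV x) - c <= 4 * (phi x - c).
Proof.
(* [phi - c] is again superharmonic and its four neighbouring values are nonnegative, so each is at
   most their sum. *)
move=> sh phic x; have := sh x.
have := phic (act_a x); have := phic (act_b x).
by have := phic (act_aV x); have := phic (act_bV x); split; lra.
Qed.

Lemma superharmonic_leave_ray1 phi x : superharmonic phi ->
  (forall y, 0 <= phi y) -> exists2 y : dyadic01 R, (y : R) < 7 / 8 & phi y <= phi x.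
Proof.
move=> sh phi0.
(* Along a ray to 1, b points away from 1 and phi is concave, so b decreases phi. *)
have step y : 7 / 8 <= (y : R) -> phi (act_b y) <= phi y.
  move=> y78; pose z := act_b y.
  have z34 : 3 / 4 <= (z : R).
    by have /= [_ _ _ ->] := b_funE (y : R); have := dyadic01_lt1 y; lra.
  have := concave_ge0_nondecreasing (fun m => phi (iter m act_bV z)) 0 1
    (fun m => phi0 _) (superharmonic_concave_ray1 phi z sh z34).
  by rewrite /= /z thompson_actK.
(* On [7/8, 1] the map [b] doubles the distance to 1, so [n] applications are enough to leave this
   interval. *)
have [n] : exists n, 1 / 8 < (1 - (x : R)) * 2 ^+ n.
  have x1 : 0 < 1 - (x : R) by rewrite subr_gt0 dyadic01_lt1.
  have [N _ /(_ N (leqnn N))/=] := near_infty_natSinv_expn_lt (PosNum x1).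
  by rewrite ltr_pdivrMr ?exprn_gt0//= => ?; exists N; lra.
elim: n x => [|n IH] x.
  by rewrite expr0 mulr1 => ?; exists x => //; lra.
have [x78|x78] := ltP (x : R) (7 / 8); first by exists x.
move=> hn; have [|y y78 yx] := IH (act_b x).
  have /= [_ _ _ ->] := b_funE (x : R); last by have := dyadic01_lt1 x; lra.
  by move: hn; rewrite exprS; lra.
by exists y => //; exact: le_trans yx (step _ x78).
Qed.

Lemma superharmonic_enter_ray0 phi (c : R) : superharmonic phi ->
  (forall y, 0 <= phi y) -> (forall y, c <= phi y) ->
  forall x, exists2 w : dyadic01 R, (w : R) <= 1 / 2 & phi w - c <= 64 * (phi x - c).
Proof.
move=> sh phi0 phic x.
have bhar y := proj1 (superharmonic_harnack phi c sh phic y).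
have ahar y := proj2 (superharmonic_harnack phi c sh phic y).
(* b maps [3/4, 7/8] to [5/8, 3/4] and [1/2, 3/4] to [1/2, 5/8], and a^-1 maps
   the latter to [1/4, 1/2]; each step costs a factor 4. *)
have [y1 hy1 le1] := superharmonic_leave_ray1 phi x sh phi0.
have [y2 hy2 le2] : exists2 y : dyadic01 R, (y : R) < 3 / 4 &
    phi y - c <= 4 * (phi y1 - c).
  have := phic y1; have [y34|y34] := ltP (y1 : R) (3 / 4) => ?.
    by exists y1 => //; lra.
  exists (act_b y1) => //=.
  by have [_ _ bE _] := b_funE (y1 : R); rewrite bE; lra.
have [y3 hy3 le3] : exists2 y : dyadic01 R, (y : R) < 5 / 8 &
    phi y - c <= 4 * (phi y2 - c).
  have := phic y2; have [y12|y12] := leP (y2 : R) (1 / 2) => ?.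
    by exists y2; lra.
  exists (act_b y2) => //=.
  by have [_ bE _ _] := b_funE (y2 : R); rewrite bE; lra.
exists (act_aV y3); last by have := ahar y3; lra.
have y0 := dyadic01_gt0 (act_aV y3); have y1' := dyadic01_lt1 (act_aV y3).
have /(congr1 (@dyadic01_val R)) /= := thompson_actKV gen_a y3.
by rewrite /a_fun; repeat case: ifPn => ?; lra.
Qed.

Lemma superharmonic_ray0_near_inf phi (c d : R) n : superharmonic phi ->
  (forall y, 0 <= phi y) -> (forall y, c <= phi y) ->
  (forall e, 0 < e -> exists x, phi x < c + e) -> 0 < d ->
  exists2 w : dyadic01 R, (w : R) <= 1 / 2 & phi (iter n act_aV w) <= c + d.
Proof.
move=> sh phi0 phic cinf d0.
(* The factor 64 pays for entering a ray and [4 ^+ n] for the [n] steps along it. *)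
have e0 : 0 < d / (64 * 4 ^+ n) by rewrite divr_gt0 ?mulr_gt0 ?exprn_gt0.
have [x hx] := cinf _ e0.
have [w w12 hw] := superharmonic_enter_ray0 phi c sh phi0 phic x.
exists w => //.
have iterE : phi (iter n act_aV w) - c <= 4 ^+ n * (phi w - c).
  elim: n {e0 hx} => [|m IH]; first by rewrite expr0 mul1r.
  have [_] := superharmonic_harnack phi c sh phic (iter m act_aV w).
  by rewrite exprS iterS; lra.
have := ler_wpM2l (exprn_ge0 n (ler0n R 4)) hw.
have : phi x - c <= d / (64 * 4 ^+ n) by lra.
by rewrite ler_pdivlMr ?mulr_gt0 ?exprn_gt0//; lra.
Qed.

End Thompson.

(** * Min-functions under the lamplighter action, and the limit *)

Lemma min_function_act_close {R : realType} (phi : dyadic01 R -> R)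
    (g : lamplighter R) (E : {fset dyadic01 R}) (e : R) :
  E != fset0 -> e <= 1 ->
  (forall x, x \in E -> thompson_act (lamp_shift g) x \notin lamp_set g) ->
  (forall x, x \in E ->
    `|phi (thompson_act (lamp_shift g) x) - phi x| <= e * phi x) ->
  (forall q, q \in lamp_set g -> (1 - e) * min_function phi E <= phi q) ->
  `|min_function phi (lamplighter_act g E) - min_function phi E|
    <= e * min_function phi E.
Proof.
move=> E0 e1 gE_out close large.
have [[x xE minE] minE_le] := min_functionP phi E0.
(* The translated minimiser is not cancelled by a lamp: it bounds the new minimum from above and
   keeps the new set nonempty, away from the default value of [min_function]. *)
have gxE : thompson_act (lamp_shift g) x \in lamplighter_act g E.
  by rewrite in_symdiff in_thompson_image thompson_actK xE (negbTE (gE_out x xE)).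
have gE0 : lamplighter_act g E != fset0.
  by apply/fset0Pn; exists (thompson_act (lamp_shift g) x).
have [[y yE minE'] /(_ _ gxE) le_gx] := min_functionP phi gE0.
have := close x xE; rewrite -minE !ler_norml => /andP[_ close_x].
apply/andP; split; last lra.
(* A point of the new set is either a lamp, covered by [large], or the translate of a point of
   [E]. *)
suff : (1 - e) * min_function phi E <= phi y by lra.
move: yE; rewrite in_symdiff in_thompson_image.
have [yL _|_ /= zE] := boolP (y \in lamp_set g); first exact: large.
set z := thompson_act _ _ in zE; have := close z zE.
rewrite thompson_actKV ler_norml => /andP[+ _].
by have := ler_wpM2l (_ : 0 <= 1 - e) (minE_le z zE);
  rewrite subr_ge0 => /(_ e1); lra.
Qed.

Theorem theorem12 (R : realType) (k : nat) (k_gt0 : (0 < k)%N)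
    (phi : 'I_k -> dyadic01 R -> R)
    (phi_gt0 : forall i q, 0 < phi i q)
    (phi_superharmonic : forall i, superharmonic (phi i))
    (phi_max : forall i q, phi i q <= phi i root_point)
    (lambda : 'I_k -> R)
    (lambda_gt0 : forall i, 0 < lambda i) :
  let f := fun E : {fset dyadic01 R} =>
    \sum_(i < k) lambda i * min_function (phi i) E in
  exists E : nat -> {fset dyadic01 R},
    forall g : lamplighter R,
      (fun n => f (lamplighter_act g (E n)) / f (E n)) @ \oo --> (1 : R).
Proof.
move=> f.
have phi_ge0 i q : 0 <= phi i q by exact: ltW.
pose c i := inf (range (phi i)).
have phi_lb i : has_lbound (range (phi i)) by exists 0 => _ [q _ <-].
have phi_inf i : has_inf (range (phi i)).
  by split=> //; exists (phi i root_point), root_point.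
have phi_c i q : c i <= phi i q by apply: ge_inf => //; exists q.
have c_inf i e : 0 < e -> exists x, phi i x < c i + e.
  by move=> e0; have [_ [x _ <-]] := inf_adherent e0 (phi_inf i); exists x.
pose ray n := iter n (thompson_act gen_a^-1%g) : dyadic01 R -> dyadic01 R.
have near_inf (p : 'I_k * nat) : exists w : dyadic01 R,
    (w : R) <= 1 / 2 /\ phi p.1 (ray p.2 w) <= c p.1 + p.2.+1%:R^-1.
  have n0 : 0 < p.2.+1%:R^-1 :> R by rewrite invr_gt0.
  by have [w ? ?] := superharmonic_ray0_near_inf (phi p.1) (c p.1) _ p.2
    (phi_superharmonic _) (phi_ge0 _) (phi_c _) (c_inf _) n0; exists w.
have [w /all_and2[w12 w_inf]] := choice near_inf.
pose E n := [fset ray n (w (i, n)) | i in 'I_k]%fset.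
have inE n i : ray n (w (i, n)) \in E n by apply/imfsetP; exists i.
have E0 n : E n != fset0.
  by apply/fset0Pn; exists (ray n (w (Ordinal k_gt0, n))); exact: inE.
have min_gt0 n i : 0 < min_function (phi i) (E n).
  by have [[x _ ->] _] := min_functionP (phi i) (E0 n).
have min_c n i : min_function (phi i) (E n) <= c i + n.+1%:R^-1.
  have [_ /(_ _ (inE n i)) le_min] := min_functionP (phi i) (E0 n).
  exact: le_trans le_min (w_inf (i, n)).
have f_gt0 n : 0 < f (E n).
  rewrite /f (bigD1 (Ordinal k_gt0))//= ltr_wpDr ?mulr_gt0//.
  by apply: sumr_ge0 => i _; rewrite mulr_ge0// ltW.
exists E => g; apply/cvgrPdist_le => e e_gt0.
(* [min_function_act_close] needs a relative error of at most 1. *)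
pose d := Num.min e 1.
have d_gt0 : 0 < d by rewrite lt_min e_gt0 ltr01.
have d_e : d <= e by rewrite ge_min lexx.
have d_1 : d <= 1 by rewrite ge_min lexx orbT.
(* A common positive lower bound of all [phi i] on the lamps of [g]; the default 1 covers the case
   of no lamps. *)
pose m := \big[Num.min/1]_(i < k)
  \big[Num.min/1]_(q <- enum_fset (lamp_set g)) phi i q.
have m_gt0 : 0 < m.
  rewrite /m; elim/big_ind: _ => // [x y x0 y0|i _]; first by rewrite lt_min x0.
  by elim/big_ind: _ => // x y x0 y0; rewrite lt_min x0.
have m_le i q : q \in lamp_set g -> m <= phi i q.
  by move=> qL; apply: (bigmin_inf i) => //; exact: bigmin_inf_seq qL _ (lexx _).
have [p p_close] := superharmonic_act_ray0 (lamp_shift g).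
have dm_gt0 : 0 < d * m by exact: mulr_gt0.
near=> n.
have n_inv : n.+1%:R^-1 < d * m.
  by near: n; exact: (near_infty_natSinv_lt (PosNum dm_gt0)).
have n_gt0 : (0 < n)%N by near: n; exact: nbhs_infty_gt.
have p_dn : p%:R <= d * n%:R.
  by rewrite mulrC -ler_pdivrMr//; near: n; exact: nbhs_infty_ger.
(* [x] may have been chosen for another index [j], so the ray estimate must be uniform in the
   function and in the starting point. *)
have close i x : x \in E n ->
    `|phi i (thompson_act (lamp_shift g) x) - phi i x| <= d * phi i x.
  case/imfsetP => j _ ->.
  have : n%:R * `|phi i (thompson_act (lamp_shift g) (ray n (w (j, n)))) -
      phi i (ray n (w (j, n)))| <= p%:R * phi i (ray n (w (j, n))).
    move: (phi i) (phi_superharmonic i) (phi_ge0 i) (w (j, n)) (w12 (j, n)).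
    by near: n.
  move=> /le_trans/(_ (ler_wpM2r (phi_ge0 i _) p_dn)).
  by rewrite mulrAC mulrC ler_pM2r ?ltr0n.
have out x : x \in E n -> thompson_act (lamp_shift g) x \notin lamp_set g.
  case/imfsetP => j _ ->.
  (* Equivalently, [x] avoids the preimage of the lamps, a finite set independent of [n]. *)
  rewrite -[lamp_shift g]invgK -in_thompson_image.
  move: (w (j, n)) (w12 (j, n)).
  by near: n; exact: ray0_avoids_fset.
have min_close i : `|min_function (phi i) (lamplighter_act g (E n)) -
    min_function (phi i) (E n)| <= d * min_function (phi i) (E n).
  apply: min_function_act_close => // [x|q qL]; first exact: close.
  (* With t = 1 / (n + 1) < d m <= d phi_i(q), one gets (1 - d)(c_i + t) <= (1 - d) phi_i(q) + t <=
     phi_i(q). This avoids dividing by [c i], which may be 0. *)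
  have := ler_wpM2l (_ : 0 <= 1 - d) (min_c n i); rewrite subr_ge0 => /(_ d_1).
  have := ler_wpM2l (ltW d_gt0) (m_le i q qL).
  have := ler_wpM2l (_ : 0 <= 1 - d) (phi_c i q); rewrite subr_ge0 => /(_ d_1).
  have : 0 <= d * n.+1%:R^-1 by rewrite mulr_ge0 ?invr_ge0// ltW.
  move: n_inv; move: (n.+1%:R^-1) => t; lra.
rewrite distrC -[X in _ - X](divff (lt0r_neq0 (f_gt0 n))) -mulrBl normrM normfV.
rewrite (gtr0_norm (f_gt0 n)) ler_pdivrMr//.
apply: le_trans (ler_wpM2r (ltW (f_gt0 n)) d_e).
(* Each term has relative error at most [d] and a positive weight, so the sum inherits the bound. *)
rewrite /f -sumrB mulr_sumr; apply: le_trans (ler_norm_sum _ _ _) _.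
apply: ler_sum => i _.
by rewrite -mulrBr normrM (gtr0_norm (lambda_gt0 i)) mulrCA ler_pM2l.
Unshelve. all: by end_near. Qed.
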